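(* Let $\mathcal T=(V,E)$ be a trie and let $\Gamma^r=\{(\hat u_i,\hat v)\in E:\ i \text{ is a } c\text{-run break, where } c=\lambda(\hat v)\}$. Then $\Gamma^r$ is a tree attractor of $\mathcal T$ and $|\Gamma^r|=r$.
   Context: A trie $\mathcal T=(V,E)$ is a rooted tree with $n$ nodes whose edges are labeled with characters of $\Sigma=\{1,\dots,\sigma\}$, totally ordered by $\prec$, such that the edges leaving any node carry pairwise distinct labels. $\lambda(\hat u)$ is the label of the edge entering $\hat u$; for the root it is $\#$, the $\prec$-smallest character, which labels no edge. $out(\hat u)$ is the set of labels of edges leaving $\hat u$. Nodes are sorted co-lexicographically: $\hat u<\hat v$ iff the root-to-node label string of $\hat u$ precedes that of $\hat v$ when compared right-to-left with $\prec$; let $\hat u_1<\dots<\hat u_n$ be the sorted nodes. For $c\in\Sigma$ and $1\le i\le n$, $i$ is a $c$-run break if $c\in out(\hat u_i)$ and either $i=n$ or $c\notin out(\hat u_{i+1})$; $r$ is the total number of pairs $(i,c)$ with $i$ a $c$-run break. For $U\subseteq V$, $\mathcal T(U)$ denotes the subgraph of $\mathcal T$ induced by $U$; it is a subtree if connected. A tree attractor is a set $\Gamma\subseteq E$ such that every subtree $\mathcal T(U)$, $U\subseteq V$, has at least one occurrence $\mathcal T(U')=(U',E')$ isomorphic to it (as rooted edge-labeled trees) with $\Gamma\cap E'\neq\emptyset$.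
   Formalization: In the definition of tree attractor only subtrees with at least one edge are considered: a single-node (or empty) subtree has no edges, so no occurrence of it could meet Γ and the claim read literally would fail for every trie. *)

(* Defs.v *)
From HB Require Import structures.
From mathcomp Require Import all_boot all_order.

Set Implicit Arguments.
Unset Strict Implicit.
Unset Printing Implicit Defensive.

Import Order.TTheory.
Local Open Scope order_scope.

(* The alphabet [A] is the finite total order {#} + Sigma, with least element
   [hash] = #, so Sigma is [A] without [hash]; # < 1 < .. < sigma is the case
   [A] = ['I_sigma.+1], [hash] = [ord0].

   The tree is an arborescence: edges are directed from parent to child, the
   root has no incoming edge, every node has at most one, and every node is
   reachable from the root.  As the edge entering a node is unique, edge labels
   are carried by their target: [lab v] is the label of the edge entering [v]. *)
Record trie (d : Order.disp_t) (A : finOrderType d) := Trie {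
  node :> finType;
  edge : rel node;
  root : node;
  hash : A;
  lab : node -> A;
  hash_min : forall c, hash <= c;
  root_no_parent : forall u, ~~ edge u root;
  parent_unique : forall u u' v, edge u v -> edge u' v -> u = u';
  root_reach : forall v, connect edge root v;
  lab_root : lab root = hash;
  lab_edge : forall u v, edge u v -> lab v != hash;
  lab_children_inj : forall u v v',
    edge u v -> edge u v' -> lab v = lab v' -> v = v'
}.
Arguments edge {d A} t.
Arguments root {d A} t.
Arguments hash {d A} t.
Arguments lab {d A} t.

Section TrieDefs.
Variables (d : Order.disp_t) (A : finOrderType d) (T : trie A).
Implicit Types (u v : T) (c : A) (U : {set T}) (G : {set T * T}).

Definition edges : {set T * T} := [set e | edge T e.1 e.2].

Definition out u : {set A} := [set lab T v | v in T & edge T u v].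

Lemma root_path_subproof v :
  exists p : seq T, path (edge T) (root T) p && (last (root T) p == v).
Proof.
have /connectP[p ep ->] := root_reach v.
by exists p; rewrite ep eqxx.
Qed.

(* The nodes on the path from the root (excluded) to [v] (included). *)
Definition root_path v : seq T := xchoose (root_path_subproof v).

(* The root contributes its label #, so label strings start with #. *)
Definition root_string v : seq A := map (lab T) (root T :: root_path v).

Definition colex_le u v : bool :=
  (rev (root_string u) : seqlexi A) <= (rev (root_string v) : seqlexi A).

(* Indices are 0-based: [node_at i] is the (i+1)-st node in co-lexicographic
   order, for i < #|T|. *)
Definition node_at (i : nat) : T :=
  nth (root T) (sort colex_le (enum T)) i.

Definition run_break c (i : 'I_#|T|) : bool :=
  (c \in out (node_at i)) &&
  ((i.+1 == #|T|)%N || (c \notin out (node_at i.+1))).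

(* [c] ranges over Sigma: # is never in [out u], so it has no run break. *)
Definition num_run_breaks : nat :=
  #|[set ic : 'I_#|T| * A | run_break ic.2 ic.1]|.

Definition run_break_edges : {set T * T} :=
  [set e in edges |
    [exists i : 'I_#|T|, (e.1 == node_at i) && run_break (lab T e.2) i]].

Definition induced_edges U : {set T * T} :=
  [set e in edges | (e.1 \in U) && (e.2 \in U)].

Definition induced_adj U : rel T :=
  fun u v => ((u, v) \in induced_edges U) || ((v, u) \in induced_edges U).

Definition is_subtree U : Prop :=
  U != set0 /\ {in U &, forall u v, connect (induced_adj U) u v}.

(* Edges are directed away from the root, so for connected [U] a map preserving
   directed edges sends the topmost node of [U] to that of [U']. *)
Definition induced_iso U U' : Prop :=
  exists f : T -> T,
    [/\ {in U &, injective f},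
        f @: U = U',
        {in U &, forall u v, edge T (f u) (f v) = edge T u v} &
        {in U &, forall u v, edge T u v -> lab T (f v) = lab T v}].

(* Subtrees without edges (single nodes) are left out: they have no edge that
   an attractor could contain. *)
Definition tree_attractor G : Prop :=
  G \subset edges /\
  forall U, is_subtree U -> induced_edges U != set0 ->
    exists2 U', induced_iso U U' & G :&: induced_edges U' != set0.

End TrieDefs.

Arguments num_run_breaks {d A} T.
Arguments run_break_edges {d A} T.
Arguments tree_attractor {d A} T G.

(* Main.v *)
(* Call an injective label-preserving edge map of the subtree [U] into the trie
   an embedding, and pick one for which the co-lexicographic ranks of the image
   have maximal sum.  If no edge of the image is a run-break edge, then the
   co-lexicographic successor of the source of each edge has an outgoing edge
   with the same label; and whenever [u'] directly follows [u], a child of [u']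
   directly follows the child of [u] with the same label.  So moving every image
   node to its successor gives another embedding, of larger rank sum. *)
Require Import Defs.
From mathcomp Require Import all_boot all_order.

Set Implicit Arguments.
Unset Strict Implicit.
Unset Printing Implicit Defensive.

Import Order.TTheory.

Section Trie.
Variables (d : Order.disp_t) (A : finOrderType d) (T : trie A).
Implicit Types (u v w : T) (U : {set T}).

(** * Root paths and co-lexicographic keys *)

Lemma root_pathP v :
  path (edge T) (Defs.root T) (root_path v) /\
  last (Defs.root T) (root_path v) = v.
Proof. by have /andP[? /eqP] := xchooseP (root_path_subproof v). Qed.

(** This makes the path chosen in [root_path] canonical. Peeling both paths from the end, unique
    parents make them agree; as the root has no parent, neither runs out first. *)
Lemma path_from_root_unique (p q : seq T) :
  path (edge T) (Defs.root T) p -> path (edge T) (Defs.root T) q ->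
  last (Defs.root T) p = last (Defs.root T) q -> p = q.
Proof.
elim/last_ind: p q => [|p x IHp] q; case/lastP: q => [|q y] //=;
  rewrite ?rcons_path ?last_rcons.
- by move=> _ /andP[_ e] ry; move: e; rewrite -ry (negPf (root_no_parent _)).
- by move=> /andP[_ e] _ xr; move: e; rewrite xr (negPf (root_no_parent _)).
move=> /andP[pp ex] /andP[pq ey] xy; rewrite -{}xy in ey *.
by rewrite (IHp q pp pq (parent_unique ex ey)).
Qed.

Lemma root_path_root : root_path (Defs.root T) = [::].
Proof.
by have [pr lr] := root_pathP (Defs.root T); apply: path_from_root_unique.
Qed.

Lemma root_path_edge u v :
  edge T u v -> root_path v = rcons (root_path u) v.
Proof.
move=> e; have [pu lu] := root_pathP u; have [pv lv] := root_pathP v.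
apply: path_from_root_unique => //; first by rewrite rcons_path pu lu.
by rewrite last_rcons.
Qed.

Lemma root_or_child v : v = Defs.root T \/ exists u, edge T u v.
Proof.
have [] := root_pathP v; case/lastP: (root_path v) => [|p x] /=.
  by move=> _ <-; left.
rewrite rcons_path last_rcons => /andP[_ e] <-; right.
by exists (last (Defs.root T) p).
Qed.

Definition colex_key v : seqlexi A := rev (root_string v).

Lemma colex_key_root : colex_key (Defs.root T) = [:: hash T].
Proof. by rewrite /colex_key /root_string root_path_root /= lab_root. Qed.

(** Reversal puts the last label first, so comparing two keys means comparing the entering labels
    and then, on a tie, the parents. *)
Lemma colex_key_edge u v :
  edge T u v -> colex_key v = lab T v :: colex_key u.
Proof.
by move=> /root_path_edge pv;
   rewrite /colex_key /root_string pv -rcons_cons map_rcons rev_rcons.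
Qed.

Lemma colex_key_nonempty v : colex_key v <> [::].
Proof. by move/(congr1 size); rewrite size_rev. Qed.

(** By induction on key length: equal tails give equal parents, and siblings with equal labels
    coincide. The root is the only node whose key has length one. *)
Lemma colex_key_inj : injective colex_key.
Proof.
suff inj n u v :
    (size (colex_key u) <= n)%N -> colex_key u = colex_key v -> u = v.
  by move=> u v; apply: inj (leqnn _).
elim: n u v => [|n IHn] u v; first by rewrite size_rev.
have [->|[x ux]] := root_or_child u; have [->|[y vy]] := root_or_child v => //.
- by rewrite (colex_key_edge vy) colex_key_root => _ [_ /esym/colex_key_nonempty].
- by rewrite (colex_key_edge ux) colex_key_root => _ [_ /colex_key_nonempty].
rewrite (colex_key_edge ux) (colex_key_edge vy) /= ltnS => len [eq_lab eq_key].
by rewrite -(IHn _ _ len eq_key) in vy; apply: lab_children_inj ux vy eq_lab.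
Qed.

(** * Ranks in the co-lexicographic order *)

Definition rank v : nat := index v (sort (@colex_le _ _ T) (enum T)).

Lemma mem_sort_nodes v : v \in sort (@colex_le _ _ T) (enum T).
Proof. by rewrite mem_sort mem_enum. Qed.

Lemma size_sort_nodes : size (sort (@colex_le _ _ T) (enum T)) = #|T|.
Proof. by rewrite size_sort cardE. Qed.

Lemma rank_lt v : (rank v < #|T|)%N.
Proof. by rewrite -size_sort_nodes index_mem mem_sort_nodes. Qed.

Lemma rankK v : node_at T (rank v) = v.
Proof. exact: nth_index (mem_sort_nodes v). Qed.

Lemma node_atK i : (i < #|T|)%N -> rank (node_at T i) = i.
Proof.
by move=> lt_i; apply: index_uniq; rewrite ?size_sort_nodes // sort_uniq enum_uniq.
Qed.

Lemma rank_inj : injective rank.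
Proof. exact: can_inj rankK. Qed.

Lemma ltn_rank u v : (rank u < rank v)%N = (colex_key u < colex_key v)%O.
Proof.
have leP x y : (rank x <= rank y)%N -> (colex_key x <= colex_key y)%O.
  have tr : transitive (@colex_le _ _ T) by move=> ? ? ?; apply: le_trans.
  have refl : reflexive (@colex_le _ _ T) by move=> ?; apply: lexx.
  have tot : total (@colex_le _ _ T) by move=> ? ?; apply: le_total.
  by apply: (sorted_leq_index tr refl (sort_sorted tot _)); apply: mem_sort_nodes.
apply/idP/idP => [lt_uv|]; last first.
  by rewrite ltnNge; apply: contraTN => /leP; rewrite leNgt.
rewrite lt_neqAle leP ?(ltnW lt_uv) // andbT.
by apply: contraTneq lt_uv => /colex_key_inj->; rewrite ltnn.
Qed.

(** A node strictly between [v] and [v'] would carry their common label, so its parent would lie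
    strictly between the consecutive nodes [u] and [u']. *)
Lemma rank_children_succ u u' v v' :
  edge T u v -> edge T u' v' -> lab T v = lab T v' ->
  rank u' = (rank u).+1 -> rank v' = (rank v).+1.
Proof.
move=> uv uv' eq_lab u'E.
have lt_v : (rank v < rank v')%N.
  rewrite ltn_rank (colex_key_edge uv) (colex_key_edge uv') eq_lab.
  by rewrite eqhead_ltxiE -ltn_rank u'E.
apply/eqP; rewrite eqn_leq lt_v andbT leqNgt; apply/negP => gap.
set w := node_at T (rank v).+1.
have wE : rank w = (rank v).+1 by rewrite node_atK // (ltn_trans gap (rank_lt _)).
have : (rank v < rank w)%N by rewrite wE.
have : (rank w < rank v')%N by rewrite wE.
rewrite !ltn_rank (colex_key_edge uv) (colex_key_edge uv') -eq_lab.
have [->|[p pw]] := root_or_child w.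
  (* The root cannot follow [v]: its key starts with the least character, which labels no edge. *)
  rewrite colex_key_root => _ /ltxi_lehead le_hash.
  have /eqP[] := lab_edge uv.
  by apply/eqP; rewrite eq_le le_hash hash_min.
rewrite (colex_key_edge pw) => lt_wv' lt_vw.
have eq_w : lab T w = lab T v.
  by apply/eqP; rewrite eq_le (ltxi_lehead lt_wv') (ltxi_lehead lt_vw).
move: lt_wv' lt_vw; rewrite eq_w !eqhead_ltxiE -!ltn_rank u'E ltnS.
by move=> le_p lt_p; rewrite leqNgt lt_p in le_p.
Qed.

(** * Run-break edges *)

Lemma card_run_break_edges : #|run_break_edges T| = num_run_breaks T.
Proof.
(* Siblings have distinct labels, so an edge is determined by its source and its label. *)
pose h (e : T * T) := (Ordinal (rank_lt e.1), lab T e.2).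
rewrite /num_run_breaks; set S := [set _ | _].
have <- : h @: run_break_edges T = S; last first.
  rewrite card_in_imset // => -[u v] [u' v'].
  rewrite !inE /= => /andP[uv _] /andP[uv' _] [/rank_inj eq_u eq_lab].
  by rewrite -eq_u in uv' *; rewrite (lab_children_inj uv uv' eq_lab).
apply/setP=> -[i c]; rewrite inE /=; apply/imsetP/idP.
  case=> -[u v]; rewrite !inE /= => /andP[uv /existsP[j /andP[/eqP uE rb]]] [iE ->].
  by rewrite (_ : i = j) //; apply: val_inj; rewrite iE /= uE node_atK.
move=> rb; have /andP[/imsetP[v]] := rb; rewrite inE /= => uv cE _.
exists (node_at T i, v); last first.
  by congr (_, _) => //; apply: val_inj; rewrite /= node_atK.
by rewrite !inE /= uv; apply/existsP; exists i; rewrite eqxx -cE.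
Qed.

Lemma not_run_break_edge u v :
  edge T u v -> (u, v) \notin run_break_edges T ->
  exists u' v',
    [/\ rank u' = (rank u).+1, edge T u' v' & lab T v' = lab T v].
Proof.
move=> uv; rewrite !inE uv /= => /existsPn/(_ (Ordinal (rank_lt u))) /=.
rewrite /run_break /= !rankK eqxx /=.
have -> /= : lab T v \in out u by apply/imsetP; exists v; rewrite ?inE.
rewrite negb_or negbK => /andP[not_last /imsetP[v']].
rewrite inE /= => uv' eq_lab.
exists (node_at T (rank u).+1), v'; split=> //.
(* Since [u] is not the last node, [node_at] does not fall back on its default, the root. *)
by rewrite node_atK // ltn_neqAle not_last rank_lt.
Qed.

(** * Embeddings of subtrees *)

Definition restricted_edge U : rel T := fun u v => (u, v) \in induced_edges U.

Lemma restricted_edgeE U u v :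
  restricted_edge U u v = [&& edge T u v, u \in U & v \in U].
Proof. by rewrite /restricted_edge !inE. Qed.

(** An undirected path from [v] can be straightened: a step up to a parent cancels the last step of
    the directed path built so far, which is nonempty because [v] has no parent in [U]. *)
Lemma top_connect U v w :
  is_subtree U -> v \in U -> w \in U -> {in U, forall u, ~~ edge T u v} ->
  connect (restricted_edge U) v w.
Proof.
move=> [_ conU] vU wU top; have /connectP[p + ->] := conU v w vU wU.
elim/last_ind: p => [|p y IHp] /=; first by rewrite connect0.
rewrite rcons_path last_rcons => /andP[/IHp].
set x := last v p => /connectP[q pq lq] /orP[xy|yx].
  by apply: connect_trans (connect1 xy); apply/connectP; exists q.
move: yx; rewrite -/(restricted_edge U y x) restricted_edgeE => /and3P[yx yU _].
case/lastP: q pq lq => [|q z] /=.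
  by move=> _ xv; move: (top y yU); rewrite -xv yx.
rewrite rcons_path last_rcons => /andP[pq qz] zx; rewrite -{}zx in qz.
apply/connectP; exists q => //.
by move: qz; rewrite restricted_edgeE => /and3P[qx _ _]; apply: parent_unique yx qx.
Qed.

(** Boolean and on finite functions, so that an embedding of maximal weight can be selected. *)
Definition embedding U (f : {ffun T -> T}) : bool :=
  [forall u, forall v, restricted_edge U u v ==>
     (edge T (f u) (f v) && (lab T (f v) == lab T v))] && dinjectiveb f U.

Lemma embeddingP U (f : {ffun T -> T}) :
  reflect ((forall u v, restricted_edge U u v ->
              edge T (f u) (f v) /\ lab T (f v) = lab T v) /\
           {in U &, injective f})
          (embedding U f).
Proof.
apply: (iffP andP) => -[hom inj]; split; try exact/dinjectiveP.
  move=> u v uv; move/forallP/(_ u)/forallP/(_ v): hom.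
  by rewrite uv => /andP[? /eqP].
apply/forallP=> u; apply/forallP=> v; apply/implyP=> /hom[-> ->].
by rewrite eqxx.
Qed.

(** Edges are also reflected. If [v] has a parent in [U], its image is the unique parent of [f v],
    and injectivity identifies it with [u]; otherwise depths in the trie give a contradiction. *)
Lemma embedding_edge U (f : {ffun T -> T}) u v :
  is_subtree U -> embedding U f -> u \in U -> v \in U ->
  edge T (f u) (f v) = edge T u v.
Proof.
move=> subU /embeddingP[hom inj] uU vU; apply/idP/idP=> [fuv|uv]; last first.
  by have [] := hom u v; rewrite // restricted_edgeE uv uU.
have [/exists_inP[p pU pv]|/exists_inPn top] := boolP [exists p in U, edge T p v].
  have [fpv _] : edge T (f p) (f v) /\ lab T (f v) = lab T v.
    by apply: hom; rewrite restricted_edgeE pv pU.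
  by rewrite (inj u p uU pU (parent_unique fuv fpv)).
(* [v] is the top node of [U], so [f v] is an ancestor of its parent [f u]. *)
have depth x y : edge T x y -> size (root_path y) = (size (root_path x)).+1.
  by move=> /root_path_edge->; rewrite size_rcons.
have /connectP[p pp uE] := top_connect subU vU uU top.
suff : (size (root_path (f v)) <= size (root_path (f u)))%N.
  by rewrite (depth _ _ fuv) ltnn.
rewrite uE; elim/last_ind: p pp {uE} => [|p y IHp] //=.
rewrite rcons_path last_rcons => /andP[/IHp le_p /hom[fy _]].
by rewrite (depth _ _ fy) ltnW.
Qed.

Lemma embedding_iso U (f : {ffun T -> T}) :
  is_subtree U -> embedding U f -> induced_iso U (f @: U).
Proof.
move=> subU emb; have /embeddingP[hom inj] := emb; exists f; split=> //.
  by move=> u v uU vU; exact: embedding_edge subU emb uU vU.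
by move=> u v uU vU uv; have [] := hom u v; rewrite // restricted_edgeE uv uU.
Qed.

(** The absence of run breaks controls only endpoints of edges; this extends the control to every
    node of [U]. *)
Lemma subtree_node_in_edge U w :
  is_subtree U -> induced_edges U != set0 -> w \in U ->
  exists v, restricted_edge U w v \/ restricted_edge U v w.
Proof.
move=> [_ conU] /set0Pn[[a b]]; rewrite -/(restricted_edge U a b) => ab wU.
have [->|aw] := eqVneq w a; first by exists b; left.
have aU : a \in U by move: ab; rewrite restricted_edgeE => /and3P[].
have /connectP[[|x p] /=] := conU w a wU aU.
  by move=> _ /eqP; rewrite eq_sym (negPf aw).
by move=> /andP[/orP[]wx _] _; exists x; [left | right].
Qed.

Lemma embedding_shift U (f : {ffun T -> T}) :
  is_subtree U -> induced_edges U != set0 -> embedding U f ->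
  (forall u v, restricted_edge U u v -> (f u, f v) \notin run_break_edges T) ->
  exists2 g : {ffun T -> T}, embedding U g &
    {in U, forall u, rank (g u) = (rank (f u)).+1}.
Proof.
move=> subU edgesU /embeddingP[hom inj] no_break.
pose g := [ffun u => node_at T (rank (f u)).+1].
have succ u v : restricted_edge U u v ->
    [/\ rank (g u) = (rank (f u)).+1, rank (g v) = (rank (f v)).+1,
        edge T (g u) (g v) & lab T (g v) = lab T v].
  move=> uv; have [fuv <-] := hom u v uv.
  have [u' [v' [u'E uv' eq_lab]]] := not_run_break_edge fuv (no_break u v uv).
  have v'E := rank_children_succ fuv uv' (esym eq_lab) u'E.
  by rewrite !ffunE -u'E -v'E !rankK.
have gE : {in U, forall u, rank (g u) = (rank (f u)).+1}.
  by move=> u /(subtree_node_in_edge subU edgesU)[v [/succ[]|/succ[]]].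
exists g => //; apply/embeddingP; split; first by move=> u v /succ[].
move=> u v uU vU /(congr1 rank); rewrite !gE // => -[/rank_inj]; exact: inj.
Qed.

Lemma run_break_edges_attractor : tree_attractor T (run_break_edges T).
Proof.
split; first by apply/subsetP=> e; rewrite inE => /andP[].
move=> U subU edgesU.
have emb_id : embedding U [ffun u => u].
  apply/embeddingP; split=> [u v|u v _ _]; rewrite !ffunE //.
  by rewrite restricted_edgeE => /and3P[].
pose weight (f : {ffun T -> T}) := \sum_(u in U) rank (f u).
case: (arg_maxnP weight emb_id) => f emb_f max_f.
exists (f @: U); first exact: embedding_iso.
apply/negP=> /eqP disj.
have [u v uv|g emb_g gE] := embedding_shift subU edgesU emb_f.
  apply/negP=> rb; have /setP/(_ (f u, f v)) := disj.
  move: uv (uv); rewrite {1}restricted_edgeE => /and3P[_ uU vU] uv.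
  have /embeddingP[/(_ u v uv)[fuv _] _] := emb_f.
  by rewrite in_setI rb !inE /= fuv !imset_f.
(* The shift raises the weight by the cardinality of [U], which is positive. *)
have := max_f g emb_g; rewrite /weight (eq_bigr _ gE) /=.
under eq_bigr do rewrite -addn1.
rewrite big_split /= sum1_card -[X in (_ <= X)%N]addn0 leq_add2l leqn0 cards_eq0.
by case: subU => /negPf->.
Qed.

End Trie.

Theorem theorem4 (d : Order.disp_t) (A : finOrderType d) (T : trie A) :
  tree_attractor T (run_break_edges T) /\
  #|run_break_edges T| = num_run_breaks T.
Proof.
exact: conj (run_break_edges_attractor T) (card_run_break_edges T).
Qed.
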